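(* Let $m=m(x)$ be a form of degree $d$ in three variables $x=(x_1,x_2,x_3)$ (with $d$ necessarily even and $\ge 6$) satisfying the following three requirements: (R1) $m$ is positive definite; (R2) $m$ is not a sum of squares; (R3) the Hessian $H_m$ of $m$ is positive definite at the point $(1,0,0)^T$. Let $g=g(x_2,x_3)$ be any form of degree $d+2$ in two variables whose Hessian is positive definite. Then there exists a constant $\gamma>0$ such that the form $f$ of degree $d+2$ given by $$f(x)=\int_0^{x_1}\int_0^{s} m(t,x_2,x_3)\,dt\,ds+\gamma\, g(x_2,x_3)$$ is convex but not sos-convex.
   Context: A form is a homogeneous polynomial with real coefficients. A form $p$ in $n$ variables is positive definite if $p(x)>0$ for all $x\ne 0$ in $\mathbb{R}^n$. A polynomial is a sum of squares if it is a finite sum of squares of real polynomials. The Hessian of $g$ (a $2\times2$ homogeneous polynomial matrix in $(x_2,x_3)$) being positive definite means that it is a positive definite matrix at every $(x_2,x_3)\ne(0,0)$. A polynomial $p$ with Hessian $H(x)$ is sos-convex if $H(x)=V(x)^TV(x)$ for some (possibly rectangular) matrix $V(x)$ with real polynomial entries; equivalently, $y^TH(x)y$ is a sum of squares of polynomials in $(x,y)$. *)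

(* Defs.v *)
From HB Require Import structures.
From mathcomp Require Import all_boot all_order all_algebra.
(* mpoly must come before mathcomp-analysis: in the other order the notations
   of the two libraries clash. *)
From mathcomp Require Import mpoly.
From mathcomp Require Import all_classical all_reals all_analysis.

Set Implicit Arguments.
Unset Strict Implicit.
Unset Printing Implicit Defensive.

Import Order.TTheory GRing.Theory Num.Theory.
Import numFieldNormedType.Exports.

Local Open Scope classical_set_scope.
Local Open Scope ring_scope.

Definition vec2 (R : realType) (a b : R) : 'cV[R]_2 :=
  \col_(i < 2) [:: a; b]`_i.

Definition vec3 (R : realType) (a b c : R) : 'cV[R]_3 :=
  \col_(i < 3) [:: a; b; c]`_i.

Definition peval (R : realType) (n : nat) (p : {mpoly R[n]})
    (x : 'cV[R]_n) : R :=
  p.@[fun i => x i ord0].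

Definition posdef_form (R : realType) (n : nat) (p : {mpoly R[n]}) : Prop :=
  forall x : 'cV[R]_n, x != 0 -> 0 < peval p x.

Definition is_sos (R : realType) (n : nat) (p : {mpoly R[n]}) : Prop :=
  exists s : seq {mpoly R[n]}, p = \sum_(q <- s) q ^+ 2.

Definition hessian (R : realType) (n : nat) (p : {mpoly R[n]}) :
    'M[{mpoly R[n]}]_n :=
  \matrix_(i < n, j < n) mderiv j (mderiv i p).

Definition hessian_at (R : realType) (n : nat) (p : {mpoly R[n]})
    (x : 'cV[R]_n) : 'M[R]_n :=
  map_mx (fun q => peval q x) (hessian p).

Definition posdef_mx (R : realType) (n : nat) (A : 'M[R]_n) : Prop :=
  A^T = A /\ forall y : 'cV[R]_n, y != 0 -> 0 < (y^T *m A *m y) ord0 ord0.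

Definition sos_convex (R : realType) (n : nat) (p : {mpoly R[n]}) : Prop :=
  exists (k : nat) (V : 'M[{mpoly R[n]}]_(k, n)), hessian p = V^T *m V.

Definition convex_poly (R : realType) (n : nat) (p : {mpoly R[n]}) : Prop :=
  @convex_function R 'cV[R]_n setT (peval p).

(* The oriented integral from a to b: the upper bound may lie below the lower
   one, whereas the library integrates over the set `[a, b], which is then
   empty. *)
Definition oint (R : realType) (a b : R) (F : R -> R) : R :=
  if a <= b then \int[lebesgue_measure]_(t in `[a, b]) F t
  else - \int[lebesgue_measure]_(t in `[b, a]) F t.

(* Main.v *)
Require Import Defs.
From HB Require Import structures.
From mathcomp Require Import all_boot all_order all_algebra.
From mathcomp Require Import mpoly.
From mathcomp Require Import all_classical all_reals all_analysis.
From mathcomp Require Import ring lra.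

(** Write I for the double antiderivative of m in the first variable, and
    Q_p(x, y) for the value at y of the Hessian form of a polynomial p at x.

    The second derivative of f = I + gamma g in the first variable is m. If
    the Hessian of f were V^T V, then its corner entry m would be the sum of
    the squares of the entries of the first column of V, which is excluded.
    Hence f is not sos-convex, whatever gamma is.

    For convexity it is enough that Q_I(x, y) + gamma Q_g(x', y') is
    nonnegative, where x' and y' drop the first coordinate: this quantity is
    the second derivative of the restriction of f to a line
    ([horner_deriv2_line], [horner_convex]). By homogeneity in x and in y only
    unit vectors matter, and these range over a compact set. On it Q_g is
    nonnegative, so a large gamma exists as soon as Q_I is positive wherever
    Q_g vanishes ([compact_penalty]). As the Hessian of g is positive definite
    away from 0, there are two cases.

    - y' = 0. Then y is a multiple of e1 and Q_I(x, y) is a positive multiple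
      of m(x), the second derivative of I in the first variable.
    - x' = 0. Then x is a multiple of e1. Every second partial derivative q
      of I is a form of degree d, so its second derivative in the first
      variable takes at e1 the value d (d - 1) q(e1); but that derivative is
      the corresponding second partial derivative of m. Hence the Hessian of m
      at e1 is d (d - 1) times that of I ([hess_form_antideriv2]), and the
      latter is positive definite too.

    The second case includes -e1 because d is even, m being positive at both
    e1 and -e1. *)

Set Implicit Arguments.
Unset Strict Implicit.
Unset Printing Implicit Defensive.

Import Order.TTheory GRing.Theory Num.Theory.
Import numFieldNormedType.Exports.

Local Open Scope classical_set_scope.
Local Open Scope ring_scope.

(** * The Hessian form *)

Definition hess_form (R : realType) (n : nat) (p : {mpoly R[n]})
    (x y : 'cV[R]_n) : R :=
  (y^T *m hessian_at p x *m y) ord0 ord0.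

Lemma hess_formE (R : realType) (n : nat) (p : {mpoly R[n]})
    (x y : 'cV[R]_n) :
  hess_form p x y =
    \sum_(i < n) \sum_(j < n)
      y i ord0 * y j ord0 * peval (mderiv j (mderiv i p)) x.
Proof.
rewrite /hess_form mxE exchange_big /=; apply: eq_bigr => j _.
rewrite mxE mulr_suml; apply: eq_bigr => i _.
by rewrite !mxE [in RHS]mulrAC.
Qed.

Lemma peval_mpolyE (R : realType) (n : nat) (p : {mpoly R[n]})
    (x : 'cV[R]_n) :
  peval p x = \sum_(k <- msupp p) p@_k * \prod_(i < n) x i ord0 ^+ k i.
Proof. by rewrite /peval mevalE. Qed.

(** * Homogeneity *)

Lemma peval_homog (R : realType) (n k : nat) (p : {mpoly R[n]}) (t : R)
    (x : 'cV[R]_n) :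
  p \is k.-homog -> peval p (t *: x) = t ^+ k * peval p x.
Proof.
move=> /dhomogP p_homog; rewrite !peval_mpolyE mulr_sumr.
apply: eq_big_seq => q q_supp.
under eq_bigr do rewrite mxE exprMn.
rewrite big_split /= mulrCA; congr (_ * (_ * _)).
by rewrite prodrXr -mdegE -(p_homog _ q_supp).
Qed.

Lemma mderiv_homog (R : realType) (n k : nat) (p : {mpoly R[n]}) (i : 'I_n) :
  p \is k.+1.-homog -> mderiv i p \is k.-homog.
Proof.
move=> /dhomogP p_homog; apply/dhomogP => q.
rewrite mcoeff_msupp mcoeff_mderiv => qn0.
have /p_homog : (q + U_(i))%MM \in msupp p.
  by rewrite mcoeff_msupp; apply: contraNneq qn0 => ->; rewrite mul0rn.
by move=> /= degS; apply/eqP; rewrite -eqSS -degS mdegD mdeg1 addn1.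
Qed.

Lemma hess_form_homog (R : realType) (n k : nat) (p : {mpoly R[n]}) (s t : R)
    (x y : 'cV[R]_n) :
  p \is (k + 2).-homog ->
  hess_form p (s *: x) (t *: y) = s ^+ k * t ^+ 2 * hess_form p x y.
Proof.
rewrite addn2 => p_homog; rewrite !hess_formE mulr_sumr.
apply: eq_bigr => i _; rewrite mulr_sumr; apply: eq_bigr => j _.
rewrite !mxE (@peval_homog _ _ k); last by do 2! apply: mderiv_homog.
by ring.
Qed.

(** * Restriction of a polynomial to a line *)

(** A polynomial in the parameter, not a mere function, so that it has a formal
    derivative. *)
Definition line (R : realType) (n : nat) (x v : 'cV[R]_n) (p : {mpoly R[n]}) :
    {poly R} :=
  mmap polyC (fun i => (x i ord0)%:P + (v i ord0)%:P * 'X) p.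

Lemma horner_line (R : realType) (n : nat) (x v : 'cV[R]_n) (p : {mpoly R[n]})
    (t : R) :
  (line x v p).[t] = peval p (x + t *: v).
Proof.
rewrite peval_mpolyE /line /mmap horner_sum; apply: eq_bigr => k _.
rewrite hornerM hornerC /mmap1 horner_prod; congr (_ * _).
apply: eq_bigr => i _.
by rewrite horner_exp !hornerE !mxE mulrC.
Qed.

(** The chain rule. Both sides are linear in p and satisfy the same Leibniz
    rule, so it is enough that they agree on the variables. *)
Lemma deriv_line (R : realType) (n : nat) (x v : 'cV[R]_n) (p : {mpoly R[n]}) :
  (line x v p)^`() = \sum_(i < n) (v i ord0)%:P * line x v (mderiv i p).
Proof.
pose D1 := deriv \o line x v.
pose D2 := fun q => \sum_(i < n) (v i ord0)%:P * line x v (mderiv i q).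
have lineZ c q : line x v (c *: q) = c%:P * line x v q by exact: mmapZ.
have lineD q r : line x v (q + r) = line x v q + line x v r.
  exact: raddfD.
have lineM q r : line x v (q * r) = line x v q * line x v r.
  exact: rmorphM.
have D2M q r : D2 (q * r) = D2 q * line x v r + line x v q * D2 r.
  rewrite /D2 mulr_suml mulr_sumr -big_split; apply: eq_bigr => i _.
  by rewrite mderivM lineD !lineM mulrDr mulrA; congr (_ + _); rewrite mulrCA.
have D12M q r : D1 q = D2 q -> D1 r = D2 r -> D1 (q * r) = D2 (q * r).
  by rewrite /D1 /= => eq er; rewrite lineM derivM eq er D2M.
have D121 : D1 1 = D2 1.
  rewrite /D1 /= [line _ _ _]rmorph1 /D2 big1 ?derivC// => i _.
  by rewrite -mpolyC1 mderivC [line _ _ _]raddf0 mulr0.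
suff: D1 p = D2 p by [].
have D12X i : D1 'X_i = D2 'X_i.
  rewrite /D1 /D2 /= /line mmapX mmap1U (bigD1 i) //= big1 => [|j ji].
    rewrite addr0 mderivX mnm1E eqxx scale1r -{1}[U_(i)%MM]add0m addmK mpolyX0 rmorph1 mulr1.
    by rewrite derivD derivC add0r derivM derivC mul0r add0r derivX mulr1.
  by rewrite mderivX mnm1E eq_sym (negPf ji) scale0r [mmap _ _ _]raddf0 mulr0.
elim/mpolyind: p => [|c k p _ _ IH].
  rewrite /D1 /= [line _ _ _]raddf0 /D2 big1 ?deriv0// => i _.
  by rewrite mderiv0 [line _ _ _]raddf0 mulr0.
have D1P q r : D1 (c *: q + r) = c%:P * D1 q + D1 r.
  by rewrite /D1 /= lineD lineZ derivD derivM derivC mul0r add0r.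
have D2P q r : D2 (c *: q + r) = c%:P * D2 q + D2 r.
  rewrite /D2 mulr_sumr -big_split; apply: eq_bigr => i _.
  by rewrite mderivD mderivZ lineD lineZ mulrDr mulrCA.
rewrite D1P D2P IH; congr (_ * _ + _).
rewrite mpolyXE_id; apply: (big_ind (fun q => D1 q = D2 q)) => // i _.
by elim: (k i) => [|e IHe]; rewrite ?expr0// exprS; exact: D12M.
Qed.

Lemma horner_deriv2_line (R : realType) (n : nat) (x v : 'cV[R]_n)
    (p : {mpoly R[n]}) (t : R) :
  (line x v p)^`()^`().[t] = hess_form p (x + t *: v) v.
Proof.
rewrite deriv_line raddf_sum horner_sum hess_formE; apply: eq_bigr => i _ /=.
rewrite derivM derivC mul0r add0r deriv_line hornerM horner_sum mulr_sumr.
apply: eq_bigr => j _.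
by rewrite !hornerM !hornerC horner_line mulrA.
Qed.

(** Euler's identity of second order: a form of degree k restricts to the line
    from 0 through x as p(x) t^k, whose second derivative is read at t = 1. *)
Lemma hess_form_diag (R : realType) (n k : nat) (p : {mpoly R[n]})
    (x : 'cV[R]_n) :
  p \is k.-homog -> hess_form p x x = (k * k.-1)%:R * peval p x.
Proof.
move=> p_homog.
have lineE : horner (line 0 x p) = horner ((peval p x)%:P * 'X^k).
  apply/funext => t; rewrite horner_line add0r (peval_homog _ _ p_homog).
  by rewrite !hornerE mulrC.
have := horner_deriv2_line 0 x p 1.
rewrite add0r scale1r => <-.
rewrite derivE derivE lineE -!derivE derivM derivC mul0r add0r derivM derivC.
rewrite mul0r add0r derivXn derivMn derivXn !hornerE hornerMn hornerMn.
by rewrite hornerXn expr1n mulrC -mulrnA mulnC.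
Qed.

(** * Compactness *)

(** Only the compact part N of K on which F <= 0 needs a penalty. There G
    cannot vanish, so it has a positive minimum, while F is bounded below. *)
Lemma compact_penalty (R : realType) (T : topologicalType) (K : set T)
    (F G : T -> R) :
  compact K -> continuous F -> continuous G ->
  (forall w, K w -> 0 <= G w) ->
  (forall w, K w -> G w = 0 -> 0 < F w) ->
  exists2 gamma : R, 0 < gamma & forall w, K w -> 0 < F w + gamma * G w.
Proof.
move=> K_compact F_cont G_cont G_ge0 F_gt0.
pose N := K `&` F @^-1` [set r | r <= 0].
have N_compact : compact N.
  apply: compact_closedI => //.
  by apply: closed_comp => // w _; exact: F_cont.
have [N_nonempty|N_empty] := pselect (N !=set0); last first.
  exists 1 => // w Kw; rewrite mul1r ltr_pwDl ?G_ge0//.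
  by rewrite ltNge; apply/negP => Fw; apply: N_empty; exists w.
have [a aN aG] :=
  compact_EVT_min N_nonempty N_compact (continuous_subspaceT G_cont).
have [b bN bF] :=
  compact_EVT_min N_nonempty N_compact (continuous_subspaceT F_cont).
have [Ka Fa] : N a by exact: set_mem.
have Ga : 0 < G a.
  rewrite lt_neqAle G_ge0// andbT; apply/eqP => G0.
  by have := F_gt0 _ Ka (esym G0); rewrite ltNge Fa.
have [_ Fb] : N b by exact: set_mem.
(* On N this makes gamma * G at least 1 - F b, hence the sum at least 1. *)
exists ((1 - F b) / G a) => [|w Kw].
  by rewrite divr_gt0// subr_gt0 (le_lt_trans Fb).
have [Fw|Fw] := leP (F w) 0; last first.
  rewrite ltr_pwDl// mulr_ge0 ?G_ge0// divr_ge0 ?(ltW Ga)// subr_ge0.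
  exact: le_trans Fb ler01.
have wN : w \in N by exact/mem_set.
have : 1 - F b <= (1 - F b) / G a * G w.
  rewrite mulrAC -mulrA ler_peMr ?ler_pdivlMr ?mul1r ?aG//.
  by rewrite subr_ge0 (le_trans Fb).
by have := bF _ wN; lra.
Qed.

Lemma sum_continuous (R : realType) (T : topologicalType) (I : Type)
    (r : seq I) (F : I -> T -> R) :
  (forall i, continuous (F i)) -> continuous (fun w => \sum_(i <- r) F i w).
Proof.
by move=> F_cont; apply: continuous_big => //; exact: add_continuous.
Qed.

Lemma prod_continuous (R : realType) (T : topologicalType) (I : Type)
    (r : seq I) (F : I -> T -> R) :
  (forall i, continuous (F i)) -> continuous (fun w => \prod_(i <- r) F i w).
Proof.
by move=> F_cont; apply: continuous_big => //; exact: mul_continuous.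
Qed.

Lemma peval_continuous (R : realType) (n : nat) (T : topologicalType)
    (p : {mpoly R[n]}) (X : T -> 'cV[R]_n) :
  (forall i, continuous (fun w => X w i ord0)) ->
  continuous (fun w => peval p (X w)).
Proof.
move=> X_cont; under eq_fun do rewrite peval_mpolyE.
apply: sum_continuous => k w; apply: cvgM; first exact: cvg_cst.
move: w; apply: prod_continuous => i w.
apply: (@continuous_comp _ _ _ (fun w => X w i ord0) (@GRing.exp R ^~ (k i))).
  exact: X_cont.
exact: exprn_continuous.
Qed.

(** Here X and Y are arbitrary parametrizations, so that the lemma also covers
    a form evaluated at vectors with a coordinate removed. *)
Lemma hess_form_continuous (R : realType) (n : nat) (T : topologicalType)
    (p : {mpoly R[n]}) (X Y : T -> 'cV[R]_n) :
  (forall i, continuous (fun w => X w i ord0)) ->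
  (forall i, continuous (fun w => Y w i ord0)) ->
  continuous (fun w => hess_form p (X w) (Y w)).
Proof.
move=> X_cont Y_cont; under eq_fun do rewrite hess_formE.
apply: sum_continuous => i; apply: sum_continuous => j w.
apply: cvgM; last exact: peval_continuous.
by apply: cvgM; exact: Y_cont.
Qed.

Lemma sphere_compact (R : realType) (n : nat) :
  compact [set u : 'rV[R]_n | `|u| = 1].
Proof.
apply: bounded_closed_compact.
  by exists 1; split => // r r_gt1 u /= ->; exact: ltW.
rewrite (_ : [set u | _] = Num.norm @^-1` [set 1 : R])//.
apply: closed_comp => [u _|]; first exact: norm_continuous.
exact: closed_eq.
Qed.

Lemma cV_polar (R : realType) (n : nat) (x : 'cV[R]_n) :
  x != 0 -> exists r (u : 'rV[R]_n), [/\ 0 < r, `|u| = 1 & x = r *: u^T].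
Proof.
move=> xn0; have r_gt0 : 0 < `|x^T|.
  rewrite normr_gt0; apply: contraNneq xn0 => xT0.
  by rewrite -[x]trmxK xT0 trmx0.
exists `|x^T|, (`|x^T|^-1 *: x^T); split => //.
  by rewrite normrZ normfV normr_id mulVf// gt_eqF.
by rewrite linearZ /= trmxK scalerA mulfV ?scale1r// gt_eqF.
Qed.

(** * Polynomials in one variable: integral and convexity *)

Lemma oint_horner (R : realType) (q : {poly R}) (a b : R) :
  oint a b (horner q^`()) = q.[b] - q.[a].
Proof.
have FTC c e : c < e ->
    \int[lebesgue_measure]_(t in `[c, e]) q^`().[t] = q.[e] - q.[c].
  move=> ce; rewrite /Rintegral (@continuous_FTC2 _ _ (horner q)) //.
  - by apply: continuous_subspaceT; exact: continuous_horner.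
  - split => [t _||]; first exact: derivable_horner.
    + by apply: cvg_at_right_filter; exact: continuous_horner.
    + by apply: cvg_at_left_filter; exact: continuous_horner.
  - by move=> t _; rewrite derivE.
rewrite /oint; case: ltgtP => [ab|ba|->]; first exact: FTC.
- by rewrite FTC// opprB.
- by rewrite set_itv1 Rintegral_set1 subrr.
Qed.

Lemma horner_convex (R : realType) (q : {poly R}) (t : {i01 R}) :
  (forall s, 0 <= q^`()^`().[s]) ->
  q.[t%:inum] <= t%:inum * q.[1] + (1 - t%:inum) * q.[0].
Proof.
move=> q2_ge0.
have D1E (p : {poly R}) : 'D_1 (horner p) = horner p^`().
  by apply/funext => s; rewrite derivE derive1E.
(* [conv s a b] puts the weight s on a, so the point t of [0, 1] has weight
   1 - t. *)
have : q.[conv (1 - t%:inum)%:i01 (0 : R^o) (1 : R^o)] <=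
    conv (1 - t%:inum)%:i01 (q.[0] : R^o) (q.[1] : R^o).
  apply: (@second_derivative_convex R (horner q) 0 1) => //.
  - by move=> s _; rewrite D1E; have := q2_ge0 s; rewrite derivE derive1E.
  - by apply: cvg_at_left_filter; exact: continuous_horner.
  - by apply: cvg_at_right_filter; exact: continuous_horner.
  - by move=> s _; rewrite D1E; exact: derivable_horner.
by rewrite !convRE /= /unstable.onem subKr mulr0 add0r mulr1 addrC.
Qed.

(** * Antiderivative in the first variable *)

Definition antideriv (R : realType) (p : {mpoly R[3]}) : {mpoly R[3]} :=
  \sum_(k <- msupp p) (p@_k / (k ord0).+1%:R) *: 'X_[k + U_(ord0)].

Lemma mderiv_antideriv (R : realType) (p : {mpoly R[3]}) :
  mderiv ord0 (antideriv p) = p.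
Proof.
rewrite raddf_sum [RHS]mpolyE; apply: eq_bigr => k _ /=.
rewrite mderivZ mderivX addmK mnmDE mnm1E eqxx addn1 scalerA divfK//.
Qed.

Lemma antideriv_homog (R : realType) (p : {mpoly R[3]}) (k : nat) :
  p \is k.-homog -> antideriv p \is k.+1.-homog.
Proof.
move=> /dhomogP p_homog; rewrite /antideriv big_seq; apply: rpred_sum => q qp.
by rewrite rpredZ// dhomogX /= mdegD mdeg1 addn1 -(p_homog _ qp).
Qed.

Lemma peval_antideriv0 (R : realType) (p : {mpoly R[3]}) (b c : R) :
  peval (antideriv p) (vec3 0 b c) = 0.
Proof.
rewrite /peval raddf_sum big1// => k _ /=.
rewrite mevalZ mevalX big_ord_recl mnmDE mnm1E eqxx addn1 !mxE /=.
by rewrite expr0n /= mul0r mulr0.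
Qed.

(** The fundamental theorem of calculus on the line through (0, b, c) with
    direction e1, where the antiderivative starts from 0. *)
Lemma oint_antideriv (R : realType) (p : {mpoly R[3]}) (a b c : R) :
  oint 0 a (fun t => peval p (vec3 t b c)) = peval (antideriv p) (vec3 a b c).
Proof.
have vec3E t : vec3 t b c = vec3 0 b c + t *: vec3 1 0 0.
  by apply/colP => -[[|[|[|//]]] i3]; rewrite !mxE /= ?mulr0 ?mulr1 ?addr0 ?add0r.
have derivE1 : (line (vec3 0 b c) (vec3 1 0 0) (antideriv p))^`() =
    line (vec3 0 b c) (vec3 1 0 0) p.
  rewrite deriv_line big_ord_recl mderiv_antideriv big1 => [|i _].
    by rewrite !mxE /= mul1r addr0.
  by rewrite mxE; case: i => -[|[|//]] ?; rewrite /= mul0r.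
have -> : (fun t => peval p (vec3 t b c)) =
    horner (line (vec3 0 b c) (vec3 1 0 0) (antideriv p))^`().
  by apply/funext => t; rewrite derivE1 horner_line -vec3E.
rewrite oint_horner !horner_line -!vec3E.
by rewrite peval_antideriv0 subr0.
Qed.

(** * Forms in the last two variables *)

Definition lift_mnm (k : 'X_{1..2}) : 'X_{1..3} :=
  [multinom if unlift ord0 i is Some j then k j else 0%N | i < 3].

Definition lift_mpoly (R : realType) (g : {mpoly R[2]}) : {mpoly R[3]} :=
  \sum_(k <- msupp g) g@_k *: 'X_[lift_mnm k].

Lemma lift_mnm0 k : lift_mnm k ord0 = 0%N.
Proof. by rewrite mnmE unlift_none. Qed.

Lemma lift_mnm_lift k j : lift_mnm k (lift ord0 j) = k j.
Proof. by rewrite mnmE liftK. Qed.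

Lemma lift_mpoly_homog (R : realType) (g : {mpoly R[2]}) (k : nat) :
  g \is k.-homog -> lift_mpoly g \is k.-homog.
Proof.
move=> /dhomogP g_homog; rewrite /lift_mpoly big_seq; apply: rpred_sum => q qg.
rewrite rpredZ// dhomogX /= -(g_homog _ qg) /= !mdegE big_ord_recl lift_mnm0.
by rewrite add0n; apply/eqP; apply: eq_bigr => i _; rewrite lift_mnm_lift.
Qed.

Lemma mderiv_lift_mpoly (R : realType) (g : {mpoly R[2]}) :
  mderiv ord0 (lift_mpoly g) = 0.
Proof.
rewrite /lift_mpoly raddf_sum big1// => k _ /=.
by rewrite mderivZ mderivX lift_mnm0 scale0r scaler0.
Qed.

Lemma peval_lift_mpoly (R : realType) (g : {mpoly R[2]}) (x : 'cV[R]_3) :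
  peval (lift_mpoly g) x = peval g (row' ord0 x).
Proof.
rewrite [RHS]peval_mpolyE /peval /lift_mpoly raddf_sum; apply: eq_bigr => k _ /=.
rewrite mevalZ mevalX big_ord_recl lift_mnm0 mul1r; congr (_ * _).
by apply: eq_bigr => i _; rewrite lift_mnm_lift mxE.
Qed.

(** * Positivity of the penalized Hessian form *)

Lemma row'_eq0_vec3 (R : realType) (x : 'cV[R]_3) :
  row' ord0 x = 0 -> x = vec3 (x ord0 ord0) 0 0.
Proof.
move=> x0; apply/colP => i; case: (unliftP ord0 i) => [j|] ->.
  have := congr1 (fun A : 'cV_2 => A j ord0) x0; rewrite !mxE /= => ->.
  by case: j => -[|[|]].
by rewrite mxE.
Qed.

Lemma hess_form_vec3 (R : realType) (p : {mpoly R[3]}) (x : 'cV[R]_3) (c : R) :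
  hess_form p x (vec3 c 0 0) = c ^+ 2 * peval (mderiv ord0 (mderiv ord0 p)) x.
Proof.
rewrite hess_formE big_ord_recl [X in _ + X]big1 => [|i _]; last first.
  rewrite big1// => j _; rewrite mxE.
  by case: i => -[|[|//]] ?; rewrite /= !mul0r.
rewrite addr0 big_ord_recl [X in _ + X]big1 => [|j _]; last first.
  by rewrite !mxE; case: j => -[|[|//]] ?; rewrite /= mulr0 mul0r.
by rewrite addr0 !mxE.
Qed.

(** A second partial derivative p of the double antiderivative is a form of
    degree d, so by [hess_form_diag] at e1 its second derivative in the first
    variable is d (d - 1) p(e1). Partial derivatives commute, so that second
    derivative is also the partial derivative of m with the same indices. *)
Lemma hess_form_antideriv2 (R : realType) (d : nat) (m : {mpoly R[3]})
    (y : 'cV[R]_3) :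
  m \is d.-homog ->
  hess_form m (vec3 1 0 0) y =
    (d * d.-1)%:R * hess_form (antideriv (antideriv m)) (vec3 1 0 0) y.
Proof.
move=> m_homog; rewrite !hess_formE mulr_sumr; apply: eq_bigr => i _.
rewrite mulr_sumr; apply: eq_bigr => j _; rewrite mulrCA; congr (_ * _).
pose p := mderiv j (mderiv i (antideriv (antideriv m))).
have p_homog : p \is d.-homog.
  by do 2! apply: mderiv_homog; do 2! apply: antideriv_homog.
rewrite -(hess_form_diag _ p_homog) hess_form_vec3 expr1n mul1r /p.
rewrite (mderiv_comm j ord0) (mderiv_comm i ord0).
by rewrite (mderiv_comm j ord0) (mderiv_comm i ord0) !mderiv_antideriv.
Qed.

Lemma posdef_mx_hess_form (R : realType) (n : nat) (p : {mpoly R[n]})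
    (x y : 'cV[R]_n) :
  posdef_mx (hessian_at p x) -> y != 0 -> 0 < hess_form p x y.
Proof. by move=> [_ pd]; exact: pd. Qed.

Lemma hess_form0r (R : realType) (n : nat) (p : {mpoly R[n]}) (x : 'cV[R]_n) :
  hess_form p x 0 = 0.
Proof. by rewrite /hess_form mulmx0 mxE. Qed.

Lemma hess_form0l (R : realType) (n k : nat) (p : {mpoly R[n]})
    (y : 'cV[R]_n) :
  p \is (k + 2).-homog -> (0 < k)%N -> hess_form p 0 y = 0.
Proof.
move=> p_homog k_gt0; rewrite -(scale0r 0) -[y]scale1r.
by rewrite (hess_form_homog _ _ _ _ p_homog) expr0n gtn_eqF// !mul0r.
Qed.

(** Compactness of the product of two unit spheres yields gamma; homogeneity in
    x and in y extends the inequality to all vectors. *)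
Lemma hess_penalty (R : realType) (d : nat)
    (m : {mpoly R[3]}) (g : {mpoly R[2]})
    (m_form : m \is d.-homog)
    (m_posdef : posdef_form m)
    (m_hess : posdef_mx (hessian_at m (vec3 1 0 0)))
    (g_form : g \is (d + 2).-homog)
    (g_hess : forall x : 'cV[R]_2, x != 0 -> posdef_mx (hessian_at g x)) :
  exists2 gamma : R, 0 < gamma &
    forall x y, 0 <= hess_form (antideriv (antideriv m)) x y
                     + gamma * hess_form g (row' ord0 x) (row' ord0 y).
Proof.
pose I := antideriv (antideriv m).
have I_form : I \is (d + 2).-homog.
  by rewrite addn2 /I; do 2! apply: antideriv_homog.
pose e1 : 'cV[R]_3 := vec3 1 0 0.
have vec3E c : vec3 c 0 0 = c *: e1 :> 'cV[R]_3.
  by apply/colP => -[[|[|[|//]]] ?]; rewrite !mxE /= ?mulr1 ?mulr0.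
have e1_neq0 : e1 != 0.
  by apply/eqP => /colP/(_ ord0); rewrite !mxE; apply/eqP; exact: oner_neq0.
have m_e1 : 0 < peval m e1 by exact: m_posdef.
(* The value of the Hessian form of m at (e1, e1) is d (d - 1) m(e1), so its
   positivity forces d >= 2. *)
have dd_gt0 : 0 < (d * d.-1)%:R :> R.
  by rewrite -(pmulr_lgt0 _ m_e1) -(hess_form_diag _ m_form)
    posdef_mx_hess_form.
have d_gt0 : (0 < d)%N by move: dd_gt0; rewrite ltr0n muln_gt0 => /andP[].
have d_even : ~~ odd d.
  apply/negP => d_odd; have : 0 < peval m (- 1 *: e1).
    by apply: m_posdef; rewrite scaler_eq0 oppr_eq0 oner_eq0.
  rewrite (peval_homog _ _ m_form) -signr_odd d_odd expr1 mulN1r oppr_gt0.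
  by rewrite ltNge (ltW m_e1).
pose F := fun w : 'rV[R]_3 * 'rV[R]_3 => hess_form I w.1^T w.2^T.
pose G := fun w : 'rV[R]_3 * 'rV[R]_3 =>
  hess_form g (row' ord0 w.1^T) (row' ord0 w.2^T).
have coord_fst i : continuous (fun w : 'rV[R]_3 * 'rV[R]_3 => w.1 ord0 i).
  move=> w; apply: (continuous_comp (g := fun u : 'rV[R]_3 => u ord0 i)).
    exact: cvg_fst.
  exact: coord_continuous.
have coord_snd i : continuous (fun w : 'rV[R]_3 * 'rV[R]_3 => w.2 ord0 i).
  move=> w; apply: (continuous_comp (g := fun u : 'rV[R]_3 => u ord0 i)).
    exact: cvg_snd.
  exact: coord_continuous.
have F_cont : continuous F.
  apply: hess_form_continuous => i; under eq_fun do rewrite mxE.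
    exact: coord_fst.
  exact: coord_snd.
have G_cont : continuous G.
  apply: hess_form_continuous => i; under eq_fun do rewrite !mxE.
    exact: coord_fst.
  exact: coord_snd.
have G_ge0 w : 0 <= G w.
  rewrite /G; have [->|x_neq0] := eqVneq (row' ord0 w.1^T) 0.
    by rewrite (hess_form0l _ g_form).
  have [->|y_neq0] := eqVneq (row' ord0 w.2^T) 0; first by rewrite hess_form0r.
  by apply/ltW/posdef_mx_hess_form => //; exact: g_hess.
have cV_neq0 (u : 'rV[R]_3) : `|u| = 1 -> u^T != 0.
  move=> u1; apply/eqP => uT0; have := oner_neq0 R.
  by rewrite -u1 -[u]trmxK uT0 trmx0 normr0 eqxx.
have F_gt0 w : `|w.1| = 1 -> `|w.2| = 1 -> G w = 0 -> 0 < F w.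
  move=> /cV_neq0 x_neq0 /cV_neq0 y_neq0 Gw0; rewrite /F.
  have [x0|x'_neq0] := eqVneq (row' ord0 w.1^T) 0.
    rewrite (row'_eq0_vec3 x0) vec3E -[w.2^T]scale1r.
    rewrite (hess_form_homog _ _ _ _ I_form) expr1n mulr1 mulr_gt0//.
      rewrite exprn_even_gt0//; apply/orP; right.
      apply: contraNneq x_neq0 => x00.
      by rewrite (row'_eq0_vec3 x0) vec3E x00 scale0r.
    by rewrite -(pmulr_rgt0 _ dd_gt0) -hess_form_antideriv2//
      posdef_mx_hess_form.
  have [y0|y'_neq0] := eqVneq (row' ord0 w.2^T) 0; last first.
    have := posdef_mx_hess_form (g_hess _ x'_neq0) y'_neq0.
    by rewrite -/(G w) Gw0 ltxx.
  rewrite (row'_eq0_vec3 y0) hess_form_vec3 !mderiv_antideriv.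
  rewrite mulr_gt0 ?m_posdef// exprn_even_gt0//=.
  apply: contraNneq y_neq0 => y00.
  by rewrite (row'_eq0_vec3 y0) vec3E y00 scale0r.
have [gamma gamma_gt0 gammaP] := compact_penalty
  (compact_setX (@sphere_compact R 3) (@sphere_compact R 3))
  F_cont G_cont (fun w _ => G_ge0 w) (fun w Kw => F_gt0 w Kw.1 Kw.2).
exists gamma => // x y.
have [->|/cV_polar[r [u [r_gt0 u1 ->]]]] := eqVneq x 0.
  rewrite (hess_form0l _ I_form)// add0r (_ : row' ord0 0 = 0).
    by rewrite (hess_form0l _ g_form)// mulr0.
  by apply/matrixP => i j; rewrite !mxE.
have [->|/cV_polar[s [v [s_gt0 v1 ->]]]] := eqVneq y 0.
  rewrite hess_form0r add0r (_ : row' ord0 0 = 0) ?hess_form0r ?mulr0//.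
  by apply/matrixP => i j; rewrite !mxE.
have row'Z a (z : 'cV[R]_3) : row' ord0 (a *: z) = a *: row' ord0 z.
  by apply/matrixP => i j; rewrite !mxE.
rewrite !row'Z (hess_form_homog _ _ _ _ I_form) (hess_form_homog _ _ _ _ g_form).
rewrite [gamma * _]mulrCA -mulrDr mulr_ge0 ?mulr_ge0 ?exprn_ge0 ?(ltW r_gt0) ?(ltW s_gt0)//.
by apply/ltW/(gammaP (u, v)).
Qed.

(** * The theorem *)

Theorem theorem3p18 (R : realType) (d : nat)
    (m : {mpoly R[3]}) (g : {mpoly R[2]})
    (m_form : m \is d.-homog)
    (R1 : posdef_form m)
    (R2 : ~ is_sos m)
    (R3 : posdef_mx (hessian_at m (vec3 1 0 0)))
    (g_form : g \is (d + 2).-homog)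
    (g_hess : forall x : 'cV[R]_2, x != 0 -> posdef_mx (hessian_at g x)) :
  exists gamma : R, 0 < gamma /\
    exists f : {mpoly R[3]},
      [/\ f \is (d + 2).-homog,
          forall x1 x2 x3 : R,
            peval f (vec3 x1 x2 x3) =
              oint 0 x1 (fun s => oint 0 s (fun t => peval m (vec3 t x2 x3)))
              + gamma * peval g (vec2 x2 x3),
          convex_poly f
        & ~ sos_convex f].
Proof.
have [gamma gamma_gt0 hess_ge0] := hess_penalty m_form R1 R3 g_form g_hess.
exists gamma; split => //.
pose I := antideriv (antideriv m).
exists (I + gamma *: lift_mpoly g).
have pevalE x : peval (I + gamma *: lift_mpoly g) x =
    peval I x + gamma * peval g (row' ord0 x).
  by rewrite {1}/peval mevalD mevalZ -!/(peval _ _) peval_lift_mpoly.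
split.
- rewrite rpredD// ?rpredZ ?lift_mpoly_homog//.
  by rewrite addn2; do 2! apply: antideriv_homog.
- move=> x1 x2 x3; rewrite pevalE; congr (_ + _ * peval g _).
    by under eq_fun do rewrite oint_antideriv; rewrite oint_antideriv.
  by apply/colP => -[[|[|//]] ?]; rewrite !mxE.
- move=> t x y _ _.
  (* The restriction of f to the line from y to x. *)
  pose q := line y (x - y) I
    + gamma%:P * line (row' ord0 y) (row' ord0 (x - y)) g.
  have row'E s : row' ord0 (y + s *: (x - y)) =
      row' ord0 y + s *: row' ord0 (x - y).
    by apply/matrixP => i j; rewrite !mxE.
  have qE s : q.[s] = peval (I + gamma *: lift_mpoly g) (y + s *: (x - y)).
    by rewrite pevalE hornerD hornerM hornerC !horner_line row'E.
  have q2_ge0 s : 0 <= q^`()^`().[s].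
    rewrite /q !derivD !derivM !derivC !mul0r !add0r derivM derivC mul0r add0r.
    rewrite hornerD hornerM hornerC !horner_deriv2_line.
    by rewrite -row'E hess_ge0.
  have := horner_convex t q2_ge0; rewrite !qE scale1r scale0r addr0 subrKC.
  suff -> : y + t%:inum *: (x - y) = conv t (x : convex_lmodType 'cV[R]_3) y.
    by rewrite convRE.
  rewrite /conv /= /unstable.onem scalerBr scalerBl scale1r.
  exact: addrCA.
- move=> [k [V hessE]]; apply: R2.
  exists [seq V i ord0 | i <- enum 'I_k].
  have f11 : mderiv ord0 (mderiv ord0 (I + gamma *: lift_mpoly g)) = m.
    rewrite mderivD mderivZ mderiv_lift_mpoly scaler0 addr0.
    by rewrite !mderiv_antideriv.
  have := congr1 (fun A : 'M[{mpoly R[3]}]_3 => A ord0 ord0) hessE.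
  rewrite !mxE f11 => ->; rewrite big_map big_enum; apply: eq_bigr => i _.
  by rewrite mxE expr2.
Qed.
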